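(* Let $\mathcal{M}$ and $\mathcal{U}$ be Banach spaces and let $\mathcal{R}:\mathcal{M}\times\mathcal{U}\to\mathcal{U}^\ast$ be a (residual) map that is at least twice Gâteaux differentiable in its second argument, with first and second derivatives $\delta_u\mathcal{R}(m,\cdot)$ and $\delta_u^2\mathcal{R}(m,\cdot)$. Fix $m\in\mathcal{M}$, and let $u\in\mathcal{U}$ be such that $\mathcal{R}(m,u)=0$. Let $\tilde u\in\mathcal{U}$ be arbitrary, and suppose that (a) $\delta_u\mathcal{R}(m,\tilde u):\mathcal{U}\to\mathcal{U}^\ast$ is invertible, i.e. $\delta_u\mathcal{R}(m,\tilde u)^{-1}$ exists; and (b) $\delta_u^2\mathcal{R}(m,w):\mathcal{U}\times\mathcal{U}\to\mathcal{U}^\ast$ is bounded for all $w\in\{\tilde u+s(u-\tilde u): s\in[0,1]\}$. Define $u^C:=\tilde u-\delta_u\mathcal{R}(m,\tilde u)^{-1}\mathcal{R}(m,\tilde u)$, $e^C:=u-u^C$ and $\tilde e:=u-\tilde u$. Then $$\|e^C\|_{\mathcal{U}}\le\frac12\left[\sup_{s\in[0,1]}\left\|\delta_u\mathcal{R}(m,\tilde u)^{-1}\,\delta_u^2\mathcal{R}(m,\tilde u+s\tilde e)\right\|_{\mathcal{L}(\mathcal{U}\times\mathcal{U},\,\mathcal{U})}\right]\|\tilde e\|_{\mathcal{U}}^2 .$$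
   Context: $\mathcal{U}^\ast$ is the topological dual of $\mathcal{U}$. The derivatives in the second argument are defined, for $p,q\in\mathcal{U}$, by $$\delta_u\mathcal{R}(m,u)(p)=\lim_{\epsilon\to0}\frac1\epsilon\left[\mathcal{R}(m,u+\epsilon p)-\mathcal{R}(m,u)\right],\qquad \delta_u^2\mathcal{R}(m,u)(p,q)=\lim_{\epsilon\to0}\frac1\epsilon\left[\delta_u\mathcal{R}(m,u+\epsilon q)(p)-\delta_u\mathcal{R}(m,u)(p)\right].$$ $\delta_u\mathcal{R}(m,u):\mathcal{U}\to\mathcal{U}^\ast$ is a continuous linear operator, and $\delta_u^2\mathcal{R}(m,u):\mathcal{U}\times\mathcal{U}\to\mathcal{U}^\ast$ is bilinear. $\delta_u\mathcal{R}(m,\tilde u)^{-1}\delta_u^2\mathcal{R}(m,w)$ denotes the bilinear map $(p,q)\mapsto\delta_u\mathcal{R}(m,\tilde u)^{-1}\big(\delta_u^2\mathcal{R}(m,w)(p,q)\big)$ from $\mathcal{U}\times\mathcal{U}$ to $\mathcal{U}$. For Banach spaces $U,V$, $\mathcal{L}(U,V)$ is the space of continuous linear operators from $U$ to $V$ with the operator norm $\|f\|_{\mathcal{L}(U,V)}=\sup_{\|v\|_U=1}\|f(v)\|_V$. For a bilinear map $B:\mathcal{U}\times\mathcal{U}\to V$, the norm is $\|B\|_{\mathcal{L}(\mathcal{U}\times\mathcal{U},V)}=\sup_{\|p\|_{\mathcal{U}}=\|q\|_{\mathcal{U}}=1}\|B(p,q)\|_V$, and $B$ is bounded if this is finite.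 *)

(* Defs.v *)
From HB Require Import structures.
From mathcomp Require Import all_boot all_order all_algebra.
From mathcomp Require Import sesquilinear.
From mathcomp Require Import all_classical all_reals.
From mathcomp Require Import ereal topology normedtype landau derive.

Set Implicit Arguments.
Unset Strict Implicit.
Unset Printing Implicit Defensive.

Import Order.TTheory GRing.Theory Num.Theory.
Import numFieldNormedType.Exports.

Local Open Scope classical_set_scope.
Local Open Scope ring_scope.

Section Dual.
Context (R : realType) (U : normedModType R).

Definition continuous_functional : {pred U -> R^o} :=
  mem [set f : U -> R^o | linear f /\ continuous f].

Fact continuous_functional_submod_closed : submod_closed continuous_functional.
Proof.
split=> [|a f g]; rewrite ?inE /=.
- split; first by move=> a x y; rewrite /GRing.zero/= scaler0 addr0.
  exact: cst_continuous.
- move=> [fl fc] [gl gc]; split=> [b x y|x].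
    rewrite !fctE fl gl !scalerDr !scalerA (mulrC a b) -!addrA; congr (_ + _).
    by rewrite addrCA.
  by apply: cvgD; [apply: cvgZ; [exact: cvg_cst|exact: fc]|exact: gc].
Qed.

HB.instance Definition _ := GRing.isSubmodClosed.Build R (U -> R^o)
  continuous_functional continuous_functional_submod_closed.

Record dual := Dual {
  dual_fun :> U -> R^o ;
  dual_funP : dual_fun \in continuous_functional }.

HB.instance Definition _ := [isSub for dual_fun].
HB.instance Definition _ := [Choice of dual by <:].
HB.instance Definition _ := [SubChoice_isSubLmodule of dual by <:].

Lemma dual_linear (f : dual) : linear f.
Proof. by case: f => f /=; rewrite inE => -[]. Qed.

Lemma dual_continuous (f : dual) : continuous f.
Proof. by case: f => f /=; rewrite inE => -[]. Qed.

HB.instance Definition _ (f : dual) :=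
  GRing.isLinear.Build R U R^o *:%R f (@dual_linear f).

Lemma dualP (f g : dual) : f =1 g <-> f = g.
Proof. by split=> [fg|->//]; apply/val_inj/funext. Qed.

Definition dual_unit_values (f : dual) : set R :=
  [set `|f v| | v in [set v : U | `|v| = 1]].

Definition dual_norm (f : dual) : R := sup (dual_unit_values f).

Lemma dual_unit_values_ubound (f : dual) : has_ubound (dual_unit_values f).
Proof.
have /linear_boundedP[y [_ fy]] :=
  continuous_linear_bounded 0 (@dual_continuous f 0).
exists (`|y| + 1) => _ [v /= v1 <-].
rewrite -[leRHS]mulr1 -[X in _ * X]v1; apply: fy.
by rewrite (le_lt_trans (ler_norm y))// ltrDl.
Qed.

Lemma dual_norm_ge0 (f : dual) : 0 <= dual_norm f.
Proof.
have [e|/set0P[_ [v v1 _]]] := eqVneq (dual_unit_values f) set0.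
  by rewrite /dual_norm e sup0.
apply: (@le_trans _ _ `|f v|) => //; apply: ub_le_sup; last by exists v.
exact: dual_unit_values_ubound.
Qed.

Lemma le_dual_norm (f : dual) (v : U) : `|f v| <= dual_norm f * `|v|.
Proof.
have [->|v0] := eqVneq v 0; first by rewrite raddf0 !normr0 mulr0.
have nv0 : 0 < `|v| by rewrite normr_gt0.
rewrite -ler_pdivrMr//; apply: ub_le_sup; first exact: dual_unit_values_ubound.
exists (`|v|^-1 *: v) => /=.
  by rewrite normrZ normfV normr_id mulVf// gt_eqF.
by rewrite linearZ normrZ normfV normr_id mulrC.
Qed.

Lemma dual_norm_le (f : dual) (k : R) : 0 <= k ->
  (forall v, `|f v| <= k * `|v|) -> dual_norm f <= k.
Proof.
move=> k0 fk; rewrite /dual_norm; have [->|/set0P ne] :=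
  eqVneq (dual_unit_values f) set0; first by rewrite sup0.
apply: ge_sup => // _ [v /= v1 <-].
by rewrite (le_trans (fk v))// v1 mulr1.
Qed.

Let dual_normD (f g : dual) : dual_norm (f + g) <= dual_norm f + dual_norm g.
Proof.
apply: dual_norm_le => [|v]; first by rewrite addr_ge0 ?dual_norm_ge0.
rewrite (le_trans (ler_normD (f v) (g v)))// mulrDl.
by rewrite lerD// le_dual_norm.
Qed.

Let dual_normZ_le (a : R) (f : dual) : dual_norm (a *: f) <= `|a| * dual_norm f.
Proof.
apply: dual_norm_le => [|v]; first by rewrite mulr_ge0 ?dual_norm_ge0.
by rewrite [X in `|X|](_ : _ = a * f v)// normrM -mulrA ler_wpM2l ?le_dual_norm.
Qed.

Let dual_normZ (a : R) (f : dual) : dual_norm (a *: f) = `|a| * dual_norm f.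
Proof.
apply/eqP; rewrite eq_le dual_normZ_le/=.
have [->|a0] := eqVneq a 0; first by rewrite normr0 mul0r dual_norm_ge0.
rewrite -ler_pdivlMl ?normr_gt0// -normfV.
by rewrite -{1}(scalerK a0 f) dual_normZ_le.
Qed.

Let dual_norm0_eq0 (f : dual) : dual_norm f = 0 -> f = 0.
Proof.
move=> f0; apply/dualP => v; apply/eqP.
by rewrite -normr_le0 (le_trans (le_dual_norm f v))// f0 mul0r.
Qed.

HB.instance Definition _ := @Lmodule_isNormed.Build R dual dual_norm
  dual_normD dual_normZ dual_norm0_eq0.

(* On U = {0} this is sup set0, which the library sets to 0. *)
Lemma dual_normE (f : dual) :
  `|f| = sup [set `|f v| | v in [set v : U | `|v| = 1]].
Proof. by []. Qed.

End Dual.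

Section Gateaux.
Context (R : realType) (U V : normedModType R).

(* 'D_p F u is the library's directional derivative, the limit of
   h^-1 *: (F (h *: p + u) - F u) as h tends to 0 with h != 0. *)
Definition gateaux (F : U -> V) (u p : U) : V := 'D_p F u.

Definition gateaux2 (F : U -> V) (u p q : U) : V :=
  'D_q (fun w => gateaux F w p) u.

Definition gateaux_differentiable (F : U -> V) :=
  forall u, [/\ forall p, derivable F u p,
                linear (gateaux F u) & continuous (gateaux F u)].

Definition twice_gateaux_differentiable (F : U -> V) :=
  gateaux_differentiable F /\
  forall u, (forall p q, derivable (fun w => gateaux F w p) u q) /\
            bilinear_for *:%R *:%R (gateaux2 F u).

(* The maximum with 0 only matters when U = {0}: the supremum is taken in
   [0, +oo], so that the norm is then 0 rather than -oo. *)
Definition bilinear_norm (B : U -> U -> V) : \bar R :=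
  maxe 0%E (ereal_sup [set x | exists p q : U,
    [/\ `|p| = 1, `|q| = 1 & x = `|B p q|%:E]]).

Definition bilinear_bounded (B : U -> U -> V) := (bilinear_norm B < +oo)%E.

End Gateaux.

(* Main.v *)
(** Put L = dRinv and let f(s) = L (R (ut + s et)), et = u - ut, a curve in U with
    f(1) = 0, f'(0) = et and f''(s) = L (R''(ut + s et)(et, et)), so
    that e^C = - (f(1) - f(0) - f'(0)). A second order Taylor estimate for
    vector-valued functions gives the bound. Differentiating f requires L to be
    continuous, which is not assumed: it follows from Banach's bounded inverse
    theorem, as U and its dual are complete. The Taylor estimate is applied to
    f in U rather than to its scalar components, which avoids Hahn-Banach. *)

Require Import Defs.
From mathcomp Require Import all_boot all_order all_algebra.
From mathcomp Require Import all_classical all_reals.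
From mathcomp Require Import ereal topology normedtype landau derive.
From mathcomp Require Import sequences lra ring.
From HB Require Import structures.

Set Implicit Arguments.
Unset Strict Implicit.
Unset Printing Implicit Defensive.

Import Order.TTheory GRing.Theory Num.Theory.
Import numFieldNormedType.Exports.

Local Open Scope classical_set_scope.
Local Open Scope ring_scope.

(** * Completeness of the dual space *)

Lemma linear_lipschitz_continuous (K : realType) (V W : normedModType K)
    (f : {linear V -> W}) (k : K) :
  (forall v, `|f v| <= k * `|v|) -> continuous f.
Proof.
move=> fk; apply/bounded_linear_continuous/linear_boundedP; near=> r => v.
by rewrite (le_trans (fk v))// ler_wpM2r//; near: r; exact: nbhs_pinfty_ge.
Unshelve. all: by end_near. Qed.

(** A Cauchy filter has a pointwise limit because the scalars are complete. The Cauchy estimate is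
    uniform in [v] up to the factor [|v|] and survives the pointwise limit; this makes the limit
    bounded and the convergence one in norm. *)
Lemma dual_complete (K : realType) (U : normedModType K)
    (F : set_system (dual U)) : ProperFilter F -> cauchy F -> cvg F.
Proof.
move=> FF /cauchy_ballP Fc.
have {}Fc e : 0 < e -> exists2 A, F A & forall f g, A f -> A g -> `|f - g| <= e.
  move=> /Fc; rewrite near_map2 => -[[A B] /= [FA FB] AB].
  exists (A `&` B) => [|f g [Af _] [_ Bg]]; first exact: filterI.
  by have := AB (f, g) (conj Af Bg); rewrite /= -ball_normE => /ltW.
have dist (f g : dual U) (e : K) v : `|f - g| <= e -> `|f v - g v| <= e * `|v|.
  move=> fge; apply: le_trans (le_dual_norm (f - g) v) _.
  exact: ler_wpM2r.
have Gv v : exists l : K^o, (fun f : dual U => f v) @ F --> l.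
  apply/cvg_ex; apply: cauchy_cvg; apply/cauchy_ballP => e e0.
  (* The [+ 1] covers [v = 0] and makes the final inequality strict. *)
  have v1 : 0 < `|v| + 1 by rewrite ltr_wpDl.
  have [A FA Ae] := Fc _ (divr_gt0 e0 v1).
  rewrite near_map2; exists (A, A) => //= -[f g] [/= Af Ag].
  rewrite -ball_normE /=; apply: le_lt_trans (dist _ _ _ v (Ae _ _ Af Ag)) _.
  by rewrite -mulrA gtr_pMr// mulrC ltr_pdivrMr// mul1r ltrDl.
have {Gv} [G GP] := choice Gv.
have Glin : linear (G : U -> K^o).
  move=> a x y; rewrite -(cvg_lim (@norm_hausdorff K K^o) (GP (a *: x + y))).
  apply: cvg_lim; first exact: norm_hausdorff.
  rewrite (_ : (fun f : dual U => f _) =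
      fun f : dual U => a *: (f x : K^o) + f y).
    by apply: cvgD (GP y); apply: cvgZ; [exact: cvg_cst|exact: GP].
  by apply/funext => f; rewrite linearP.
(* Some [g] in [A] has [g v] within [d] of the limit, and [d] is arbitrary. *)
have near_G e A (f : dual U) v : F A ->
    (forall f g, A f -> A g -> `|f - g| <= e) -> A f ->
    `|G v - f v| <= e * `|v|.
  move=> FA Ae Af; apply/ler_addgt0Pr => d d0.
  have /cvgrPdist_le/(_ d d0) Gd := GP v.
  have [g [Ag gd]] := filter_ex (filterI FA Gd).
  rewrite -(subrKA (g v)) addrC (le_trans (ler_normD _ _))// lerD//.
  by apply: dist; exact: Ae.
have Gcont : continuous (G : U -> K^o).
  have [A FA A1] := Fc 1 ltr01; have [f Af] := filter_ex FA.
  pose Gl : {linear U -> K^o} := HB.pack (G : U -> K^o)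
    (GRing.isLinear.Build _ _ _ _ _ Glin).
  apply: (@linear_lipschitz_continuous _ _ _ Gl (1 + `|f|)) => v.
  rewrite -(subrK (f v) (Gl v)) (le_trans (ler_normD _ _))// mulrDl lerD//.
    exact: (near_G _ _ _ _ FA A1 Af).
  exact: le_dual_norm.
have GD : (G : U -> K^o) \in @continuous_functional K U by rewrite inE.
apply/cvg_ex; exists (Dual GD); apply/cvgrPdist_le => e e0.
have [A FA Ae] := Fc e e0; apply: (filterS _ FA) => f Af.
by apply: (dual_norm_le (ltW e0)) => v; exact: (near_G _ _ _ _ FA Ae Af).
Qed.

HB.instance Definition _ (K : realType) (U : normedModType K) :=
  Uniform_isComplete.Build (dual U) (@dual_complete K U).

(** * The bounded inverse theorem *)

(** Otherwise all complements would be open and dense, hence with dense intersection by Baire's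
    theorem, while the covering makes that intersection empty. *)
Lemma Baire_closed_cover (K : realType) (V : completeNormedModType K)
    (C : (set V)^nat) : (forall n, closed (C n)) -> \bigcup_n C n = setT ->
  exists n, exists x, exists2 r : K, 0 < r & ball x r `<=` C n.
Proof.
move=> Ccl CT; apply: contrapT => noball.
have /Baire/(_ setT) : forall n, open (~` C n) /\ dense (~` C n).
  move=> n; split; first exact: closed_openC.
  apply: contrapT => /denseNE[A [[x /open_nbhs_nbhs/nbhs_ballP[r r0 xrA]] AC]].
  apply: noball; exists n, x, r => // y /xrA Ay.
  by apply: contrapT => nCy; have : set0 y by rewrite -AC.
rewrite -setC_bigcup CT setCT setI0 => /(_ _ openT)[].
- by exists 0.
- by [].
Qed.

(* One step of the successive approximation in the open mapping theorem. *)
Lemma surjective_approx_preimage (K : realType) (V : normedModType K)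
    (W : completeNormedModType K) (T : {linear V -> W}) :
  (forall y, exists x, T x = y) ->
  exists2 c : K, 0 <= c &
    forall y, exists2 x, `|x| <= c * `|y| & `|y - T x| <= 2^-1 * `|y|.
Proof.
move=> Tsurj.
(* Surjectivity makes these closed sets cover [W], so one of them contains a ball. *)
pose C n := closure (T @` [set x | `|x| <= n%:R]).
have [n|  |n [y0 [r r0 rC]]] := @Baire_closed_cover _ W C.
    exact: closed_closure.
  rewrite -subTset => y _; have [x <-] := Tsurj y.
  exists (Num.truncn `|x|).+1 => //; apply: subset_closure; exists x => //=.
  exact/ltW/truncnS_gt.
exists (4 * n%:R / r) => [|y]; first by rewrite divr_ge0 ?mulr_ge0// ltW.
have [->|y_neq0] := eqVneq y 0.
  by exists 0; rewrite ?(linear0 T, subr0, normr0, mulr0).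
have y_gt0 : 0 < `|y| by rewrite normr_gt0.
have near_C z : ball y0 r z -> exists2 x, `|x| <= n%:R & `|z - T x| <= r / 8.
  move=> /rC /(_ _ (nbhsx_ballx z (r / 8) _))[|_ [[x /= xn <-]]].
    by rewrite divr_gt0.
  by rewrite -ball_normE /= => /ltW; exists x.
(* Both [y0] and its translate by a vector of length [r / 2] along [y] lie in the ball. Hence
   [x2 - x1] has norm at most [2n] and solves for that vector up to [r / 8 + r / 8]; rescaling by
   [2|y| / r] gives the norm [4n|y| / r] and the error [|y| / 2]. *)
have [x1 x1n x1y] := near_C y0 (ballxx _ r0).
have [|x2 x2n x2y] := near_C (y0 + (r / 2 / `|y|) *: y).
  rewrite -ball_normE /= opprD addNKr normrN normrZ gtr0_norm ?divr_gt0//.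
  by rewrite divfK ?gt_eqF// ltr_pdivrMr// mulr_natr mulr2n ltrDl.
have a0 : 0 < 2 * `|y| / r by rewrite divr_gt0// mulr_gt0.
exists ((2 * `|y| / r) *: (x2 - x1)).
  rewrite normrZ gtr0_norm//.
  have /(ler_wpM2l (ltW a0)) : `|x2 - x1| <= n%:R + n%:R.
    by rewrite (le_trans (ler_normB _ _))// lerD.
  move/le_trans; apply; rewrite le_eqVlt; apply/orP; left; apply/eqP.
  by field; exact: lt0r_neq0.
have -> : y - T ((2 * `|y| / r) *: (x2 - x1)) = (2 * `|y| / r) *:
    ((y0 + (r / 2 / `|y|) *: y - T x2) - (y0 - T x1)).
  have -> : y0 + (r / 2 / `|y|) *: y - T x2 - (y0 - T x1) =
      (r / 2 / `|y|) *: y - (T x2 - T x1).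
    rewrite !opprB [y0 + _]addrC [_ + y0 - _]addrAC addrACA subrr addr0.
    by rewrite -addrA [- _ + _]addrC.
  rewrite linearZ_LR linearB [RHS]scalerBr scalerA.
  suff -> : 2 * `|y| / r * (r / 2 / `|y|) = 1 by rewrite scale1r.
  by field; rewrite !gt_eqF.
rewrite normrZ gtr0_norm//.
apply: le_trans (ler_wpM2l (ltW a0) (ler_normB _ _)) _.
have /(ler_wpM2l (ltW a0)) := lerD x2y x1y.
move/le_trans; apply; rewrite le_eqVlt; apply/orP; left; apply/eqP; field.
exact: lt0r_neq0.
Qed.

(** Repeated approximate solving halves the residual each time. The corrections form an absolutely
    convergent series, whose sum is [x] by continuity and injectivity of [T]; the geometric sum
    turns [c] into [2c]. *)
Lemma bijective_linear_bounded_below (K : realType)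
    (V W : completeNormedModType K) (T : {linear V -> W}) :
  continuous T -> bijective T ->
  exists2 c : K, 0 <= c & forall x, `|x| <= c * `|T x|.
Proof.
move=> Tcont [S TK SK].
have [|c c0] := @surjective_approx_preimage _ _ _ T.
  by move=> y; exists (S y).
move=> /(_ _)/cid2; move=> /all_sig2[g gc gT].
exists (c * 2) => [|x]; first by rewrite mulr_ge0.
(* [y n] is the residual after [n] corrections, and [g (y n)] is the next correction. *)
pose y := fix y n := if n is m.+1 then y m - T (g (y m)) else T x.
have yle n : `|y n| <= `|T x| * 2^-1 ^+ n.
  elim: n => [|n IHn]; first by rewrite expr0 mulr1.
  by rewrite (le_trans (gT _))// exprS mulrCA ler_wpM2l.
have gle n : `|g (y n)| <= geometric (c * `|T x|) 2^-1 n.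
  by rewrite (le_trans (gc _))// /geometric/= -mulrA ler_wpM2l.
have half1 : `|2^-1 : K| < 1 by rewrite ger0_norm// invf_lt1// ltr1n.
have gcvg : cvgn [normed series (g \o y)].
  apply: series_le_cvg gle _ => // [n|].
    by rewrite /geometric/= mulr_ge0// mulr_ge0.
  exact: is_cvg_geometric_series.
have Tseries n : T (series (g \o y) n) = T x - y n.
  elim: n => [|n IHn]; first by rewrite seriesEnat/= big_geq// linear0 subrr.
  by rewrite seriesSr linearD IHn /= opprB addrA addrAC.
have y0 : y @ \oo --> 0.
  apply/norm_cvg0P.
  apply: (squeeze_cvgr _ (cvg_cst 0) (cvg_geometric `|T x| half1)).
  by apply: nearW => n /=; rewrite normr_ge0 yle.
have limx : limn (series (g \o y)) = x.
  apply: (can_inj TK).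
  have Tlim : (fun n => T (series (g \o y) n)) @ \oo -->
      T (limn (series (g \o y))).
    exact: (continuous_cvg _ (Tcont _) (normed_cvg gcvg)).
  rewrite -(cvg_lim (@norm_hausdorff _ _) Tlim) (funext Tseries).
  apply: cvg_lim; first exact: norm_hausdorff.
  by rewrite -[X in _ --> X]subr0; apply: cvgB => //; exact: cvg_cst.
rewrite -{1}limx (le_trans (lim_series_norm gcvg))//.
have -> : c * 2 * `|T x| = limn (series (geometric (c * `|T x|) 2^-1)).
  rewrite (cvg_lim (@norm_hausdorff _ _) (@cvg_geometric_series _ _ _ half1)).
  by field.
apply: ler_lim gcvg (@is_cvg_geometric_series _ _ _ half1) _.
by apply: nearW => n; apply: ler_sum => i _; exact: gle.
Qed.

(** * Derivatives along lines and the Taylor estimate *)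

Lemma is_derive_cvg (K : realType) (V W : normedModType K) (f : V -> W)
    (x v : V) (df : W) : is_derive x v f df ->
  (fun h : K => h^-1 *: (f (h *: v + x) - f x)) @ 0^' --> df.
Proof.
by move=> fdf; rewrite -(@derive_val _ _ _ _ _ _ _ fdf); exact: ex_derive.
Qed.

Lemma cvg_is_derive (K : realType) (V W : normedModType K) (f : V -> W)
    (x v : V) (df : W) :
  (fun h : K => h^-1 *: (f (h *: v + x) - f x)) @ 0^' --> df ->
  is_derive x v f df.
Proof. by move=> fdf; split; [apply/cvg_ex; exists df|exact/cvg_lim]. Qed.

(** Both difference quotients are the same function of [h], so directional derivability suffices and
    no Fréchet chain rule is involved. *)
Lemma is_derive_line (K : realType) (V W : normedModType K) (f : V -> W)
    (x v : V) (t : K) : derivable f (x + t *: v) v ->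
  is_derive t 1 (fun s : K => f (x + s *: v)) ('D_v f (x + t *: v)).
Proof.
move=> /derivableP/is_derive_cvg dfv; apply: cvg_is_derive.
rewrite (_ : (fun h : K => _) =
  fun h => h^-1 *: (f (h *: v + (x + t *: v)) - f (x + t *: v)))//.
by apply/funext => h; rewrite [h *: 1]mulr1 scalerDl addrCA.
Qed.

Lemma is_derive_linear_comp (K : realType) (U V W : normedModType K)
    (L : {linear V -> W}) (f : U -> V) (x v : U) (df : V) : continuous L ->
  is_derive x v f df -> is_derive x v (L \o f) (L df).
Proof.
move=> Lc /is_derive_cvg dfv; apply: cvg_is_derive.
rewrite (_ : (fun h : K => _) =
    L \o (fun h : K => h^-1 *: (f (h *: v + x) - f x))); last first.
  by apply/funext => h /=; rewrite -linearB linearZ_LR.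
exact: (continuous_cvg _ (Lc df) dfv).
Qed.

(* [c] is the last point where the inequality, relaxed by [e * (t - a)], holds;
   if [c < b], first order expansions at [c] extend it beyond [c]. *)
Lemma normr_increment_le (K : realType) (V : normedModType K)
    (f df : K -> V) (g dg : K -> K) (a b : K) : a <= b ->
  (forall t, t \in `[a, b] -> is_derive t 1 f (df t)) ->
  (forall t, t \in `[a, b] -> is_derive t 1 g (dg t)) ->
  (forall t, t \in `[a, b] -> `|df t| <= dg t) ->
  `|f b - f a| <= g b - g a.
Proof.
move=> ab fdf gdg dfg; apply/ler_addgt0Pr => e0 e0_gt0.
have ba1 : 0 < b - a + 1 by rewrite ltr_wpDl// subr_ge0.
(* This gives [e * (b - a) <= e0], also when [a = b]. *)
pose e := e0 / (b - a + 1); have e_gt0 : 0 < e by rewrite divr_gt0.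
suff : `|f b - f a| <= g b - g a + e * (b - a).
  move=> /le_trans; apply; rewrite lerD2l /e -mulrA ger_pMr// mulrC.
  by rewrite ler_pdivrMr// mul1r lerDl.
pose S := [set t | t \in `[a, b] /\ `|f t - f a| <= g t - g a + e * (t - a)].
have Sa : S a by split; rewrite ?in_itv/= ?lexx ?ab// !subrr normr0 mulr0 addr0.
have ubS : ubound S b by move=> t [+ _]; rewrite in_itv/= => /andP[].
have hubS : has_ubound S by exists b.
have supab : sup S \in `[a, b].
  by rewrite in_itv/= ub_le_sup//= ge_sup//; exists a.
have fcont t : t \in `[a, b] -> {for t, continuous f}.
  by move=> /fdf ?; apply/differentiable_continuous/derivable1_diffP.
have gcont t : t \in `[a, b] -> {for t, continuous g}.
  by move=> /gdg ?; apply/differentiable_continuous/derivable1_diffP.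
(* If [h c < 0], then [h] is negative near [c] by continuity, although [c] is in the closure of
   [S]. *)
have Ssup : S (sup S).
  split=> //; rewrite -subr_ge0; set c := sup S in supab *.
  pose h t := g t - g a + e * (t - a) - `|f t - f a|.
  rewrite -/(h c) leNgt; apply/negP => hc0.
  have hc : {for c, continuous h}.
    apply: cvgB.
      apply: cvgD; first by apply: cvgB; [exact: gcont|exact: cvg_cst].
      apply: cvgM; first exact: cvg_cst.
      by apply: cvgB; [exact: cvg_id|exact: cvg_cst].
    by apply: cvg_norm; apply: cvgB; [exact: fcont|exact: cvg_cst].
  have : closure S c by apply: closure_sup => //; exists a.
  have : nbhs c (fun t => h t < 0) by exact: (cvgr_lt _ hc).
  move=> + cl => /cl [t [[_]]] /=.
  by rewrite -subr_ge0 -/(h t) leNgt => /negP.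
set c := sup S in supab Ssup.
have [_ Sc] := Ssup.
have [<-//|cb] := eqVneq c b.
have {}cb : c < b.
  by rewrite lt_neqAle cb/=; move: supab; rewrite in_itv => /andP[].
have ac : a <= c by move: supab; rewrite in_itv => /andP[].
(* The expansions of [f] and [g] each cost [h * (e / 2)], together the slack [e * h] gained in
   passing from [c] to [h + c]. *)
have e2 : 0 < e / 2 by rewrite divr_gt0.
have /is_derive_cvg/cvgrPdist_le/(_ _ e2) fc := fdf _ supab.
have /is_derive_cvg/cvgrPdist_le/(_ _ e2) gc := gdg _ supab.
have [h [h0 hcb fh gh]] : exists h, [/\ 0 < h, h + c <= b,
    `|df c - h^-1 *: (f (h + c) - f c)| <= e / 2 &
    `|dg c - h^-1 * (g (h + c) - g c)| <= e / 2].
  have [d /= d0 dfg'] := filterI fc gc.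
  pose h := Num.min (d / 2) (b - c).
  have h0 : 0 < h by rewrite lt_min subr_gt0 cb divr_gt0.
  exists h; have [] := dfg' h.
  - rewrite /= sub0r normrN gtr0_norm// gt_min; apply/orP; left.
    by rewrite ltr_pdivrMr// mulr_natr mulr2n ltrDl.
  - exact: lt0r_neq0.
  - rewrite [h *: 1]mulr1 => fh gh; split => //.
    by rewrite -lerBrDr ge_min lexx orbT.
suff : S (h + c) by move=> /(ub_le_sup hubS); rewrite -/c gerDr leNgt h0.
split; first by rewrite in_itv/= hcb andbT (le_trans ac)// lerDr ltW.
have fhc : `|f (h + c) - f c| <= h * (`|df c| + e / 2).
  rewrite -ler_pdivrMl// -[h^-1 in X in X <= _]gtr0_norm ?invr_gt0// -normrZ.
  rewrite -[X in `|X|](subrK (df c)) (le_trans (ler_normD _ _))// addrC lerD2l.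
  by rewrite distrC.
have ghc : h * (dg c - e / 2) <= g (h + c) - g c.
  rewrite -ler_pdivlMl//; move: gh; rewrite ler_norml => /andP[_]; lra.
have dc := dfg _ supab.
have hd : h * `|df c| <= h * dg c by rewrite ler_wpM2l// ltW.
have -> : f (h + c) - f a = (f (h + c) - f c) + (f c - f a) by rewrite subrKA.
apply: le_trans (ler_normD _ _) _.
move: fhc ghc; rewrite !(mulrDr, mulrBr) => fhc ghc.
have heq : e * (h + c) = h * (e/2) + h * (e/2) + e * c by field.
move: Sc; rewrite mulrBr; lra.
Qed.

(** The lower bound on [T], taken at [S y], is a Lipschitz bound on [S]. *)
Lemma can2_continuous_linear (K : realType) (V W : completeNormedModType K)
    (T : {linear V -> W}) (S : {linear W -> V}) : continuous T ->
  cancel T S -> cancel S T -> continuous S.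
Proof.
move=> Tcont TK SK.
have [c _ cT] := bijective_linear_bounded_below Tcont (Bijective TK SK).
by apply: (@linear_lipschitz_continuous _ _ _ _ c) => y; rewrite -{2}(SK y).
Qed.

(** The increment inequality is used twice: for [df] against [C * t], then for [f t - t *: df 0]
    against the primitive [C * t ^+ 2 / 2]. *)
Lemma normr_taylor2_le (K : realType) (V : normedModType K)
    (f df d2f : K -> V) (C : K) :
  (forall t : K, t \in `[0, 1] -> is_derive t 1 f (df t)) ->
  (forall t : K, t \in `[0, 1] -> is_derive t 1 df (d2f t)) ->
  (forall t : K, t \in `[0, 1] -> `|d2f t| <= C) ->
  `|f 1 - f 0 - df 0| <= 2^-1 * C.
Proof.
move=> fdf dfd2f d2fC.
have dfC (t : K) : t \in `[0, 1] -> `|df t - df 0| <= C * t.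
  move=> t01; have /andP[t0 t1] : 0 <= t <= 1 by move: t01; rewrite in_itv.
  have sub s : s \in `[0, t] -> s \in `[0, 1].
    by rewrite !in_itv/= => /andP[-> /le_trans]; apply.
  have := @normr_increment_le _ _ df d2f (fun s => C * s) (cst C) 0 t t0.
  rewrite mulr0 subr0; apply=> s /sub; [exact: dfd2f| |exact: d2fC].
  by move=> _; apply: (is_derive_eq (is_deriveZ C _)); exact: mulr1.
have := @normr_increment_le _ _ (fun t => f t - t *: df 0)
  (fun t => df t - df 0) (fun t => 2^-1 * C * t ^+ 2) (fun t => C * t)
  0 1 ler01.
rewrite scale1r scale0r subr0 expr1n mulr1 expr0n mulr0 subr0 addrAC.
apply=> // t t01.
- apply: is_deriveB; first exact: fdf.
  apply: cvg_is_derive; apply/cvgrPdist_le => e e0.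
  near=> h; have h0 : h != 0 by near: h; exact: nbhs_dnbhs_neq.
  rewrite [h *: 1]mulr1 scalerDl addrK scalerA mulVf// scale1r.
  by rewrite subrr normr0 ltW.
- apply: (is_derive_eq (is_deriveZ (2^-1 * C) _)).
  by rewrite [t%:A]mulr1 [LHS]mulrDr -mulr2n; field.
Unshelve. all: by end_near. Qed.

(** * Bilinear norms on the diagonal and the error bound *)

Lemma bilinear_norm_ge0 (K : realType) (U V : normedModType K)
    (B : U -> U -> V) :
  (0 <= bilinear_norm B)%E.
Proof. by rewrite /bilinear_norm le_max lexx. Qed.

Lemma le_bilinear_norm (K : realType) (U V : normedModType K)
    (B : U -> U -> V) (p : U) :
  (forall q, scalable (B q)) -> (forall q, scalable (B ^~ q)) ->
  (`|B p p|%:E <= bilinear_norm B * (`|p| ^+ 2)%:E)%E.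
Proof.
(* At [p = 0] the right side is 0 even for an infinite norm, since [+oo * 0 = 0] in the extended
   reals. *)
move=> Br Bl; have [->|p0] := eqVneq p 0.
  have := Br 0 0 0; rewrite !scale0r => ->.
  by rewrite !normr0 expr0n mule0.
have np0 : 0 < `|p| by rewrite normr_gt0.
pose e := `|p|^-1 *: p.
have e1 : `|e| = 1 by rewrite normrZ normfV normr_id mulVf// gt_eqF.
have pe : p = `|p| *: e by rewrite scalerA mulfV ?gt_eqF// scale1r.
have -> : `|B p p| = `|B e e| * `|p| ^+ 2.
  rewrite {1 2}pe Br [B _ _](Bl e `|p| e) !normrZ !normr_id.
  by rewrite mulrA mulrC expr2.
rewrite EFinM lee_wpmul2r ?lee_fin ?sqr_ge0// /bilinear_norm le_max.
by apply/orP; right; apply: ereal_sup_ubound; exists e, e.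
Qed.

Theorem theorem1 (K : realType) (M U : completeNormedModType K)
    (R : M -> U -> dual U)
    (hR : forall m : M, twice_gateaux_differentiable (R m))
    (m : M) (u : U) (hu : R m u = 0) (ut : U)
    (dRinv : dual U -> U)
    (dRinvK : cancel (gateaux (R m) ut) dRinv)
    (dRinvVK : cancel dRinv (gateaux (R m) ut))
    (hbdd : forall s : K, s \in `[0, 1] ->
       bilinear_bounded (gateaux2 (R m) (ut + s *: (u - ut)))) :
  let uC := ut - dRinv (R m ut) in
  let eC := u - uC in
  let et := u - ut in
  let B (s : K) (p q : U) := dRinv (gateaux2 (R m) (ut + s *: et) p q) in
  ((`|eC|%:E <= (2^-1)%R%:E * ereal_sup [set bilinear_norm (B s) | s in `[0%R, 1%R]]
                * (`|et| ^+ 2)%R%:E)%E : Prop).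
Proof.
move=> uC eC et B.
have [dR d2R] := hR m; have [_ Tlin Tcont] := dR ut.
pose T : {linear U -> dual U} := HB.pack (gateaux (R m) ut)
  (GRing.isLinear.Build _ _ _ _ _ Tlin).
have Llin : linear dRinv.
  by move=> a x y; exact: (can2_linear (f := T) dRinvK dRinvVK).
pose L : {linear dual U -> U} := HB.pack dRinv
  (GRing.isLinear.Build _ _ _ _ _ Llin).
have Lcont : continuous L by exact: (@can2_continuous_linear _ _ _ T L).
set C := ereal_sup _.
have BC s : s \in `[0, 1] -> (bilinear_norm (B s) <= C)%E.
  by move=> s01; apply: ereal_sup_ubound; exists s.
have C0 : (0 <= C)%E.
  apply: le_trans (bilinear_norm_ge0 _) (BC 0 _).
  by rewrite in_itv/= lexx ler01.
have Bet s : s \in `[0, 1] -> (`|B s et et|%:E <= C * (`|et| ^+ 2)%:E)%E.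
  move=> s01; apply: le_trans (lee_wpmul2r _ (BC s s01)).
    2: by rewrite lee_fin sqr_ge0.
  have [_ [Bl Br]] := d2R (ut + s *: et).
  apply: le_bilinear_norm => q a p; rewrite /B.
    by rewrite (scalable_linear (Br q)); exact: (linearZ_LR L).
  by rewrite (scalable_linear (Bl q)); exact: (linearZ_LR L).
(* As [R m u = 0] and [L (T et) = et], the right side is the norm of [- L (R m ut) - et], which is
   [- eC]. *)
have eCE : `|eC| =
    `|L (R m (ut + 1 *: et)) - L (R m (ut + 0 *: et)) - L (T et)|.
  rewrite scale1r scale0r addr0 [ut + et]addrC subrK hu linear0 sub0r.
  by rewrite -opprD normrN [L (T et)]dRinvK /eC /uC /et
    opprB [LHS](congr1 Num.norm (addrCA _ _ _)).
rewrite -muleA eCE.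
(* The split is on the product rather than on [C]: with [et = 0] it is 0 even if [C] is infinite, so
   that case falls under the real-valued estimate. *)
have [Coo|Cfin] := eqVneq (C * (`|et| ^+ 2)%:E)%E +oo%E.
  by rewrite Coo gt0_muley ?leey// lte_fin invr_gt0.
have /fineK Cr : (C * (`|et| ^+ 2)%:E)%E \is a fin_num.
  by rewrite ge0_fin_numE ?ltey// mule_ge0// lee_fin sqr_ge0.
rewrite -Cr -EFinM lee_fin.
have -> : T et = gateaux (R m) (ut + 0 *: et) et by rewrite scale0r addr0.
apply: (@normr_taylor2_le _ _ (fun s => L (R m (ut + s *: et)))
  (fun s => L (gateaux (R m) (ut + s *: et) et)) (fun s => B s et et)).
- move=> s _; apply: (is_derive_linear_comp Lcont (f := fun s => _)).
  by apply: is_derive_line; have [] := dR (ut + s *: et).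
- move=> s _; apply: (is_derive_linear_comp Lcont (f := fun s => _)).
  apply: (@is_derive_line _ _ _ (fun w => gateaux (R m) w et)).
  by have [] := d2R (ut + s *: et).
- by move=> s s01; rewrite -lee_fin Cr; exact: Bet.
Qed.
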